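(* For a finite simple graph $G=(V,E)$ define $$P(G,x)=\frac{1}{2^{|V|}}Z_G(2x,-2)=\frac{1}{2^{|V|}}\sum_{A\subseteq E}(2x)^{k(A)}(-2)^{|A|},$$ which equals $(-1)^{|V|-k(G)}x^{k(G)}T(G,1-x,-1)$, where $T$ is the Tutte polynomial. Then for every simple graph $G$ and every edge $e\in E(G)$, $$P(G,x)=P(G-e,x)-P(G\Delta e,x),$$ and $P(\overline{K_n},x)=x^n$ for every $n\ge 1$, where $\overline{K_n}$ is the edgeless graph on $n$ vertices. In particular, there exists a graph polynomial (defined on all simple graphs) satisfying the recursion $P(G,x)=P(G-e,x)-P(G\Delta e,x)$ for every edge $e$ together with the initial condition $P(\overline{K_n},x)=x^n$; that is, the polynomial determined by this recursion does not depend on the order in which edges are chosen.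
   Context: All graphs are finite and simple. For a graph $G=(V,E)$ and $A\subseteq E$, $k(A)$ denotes the number of connected components of the spanning subgraph $(V,A)$, and $k(G)=k(E)$. The Tutte polynomial is $T(G,x,y)=\sum_{A\subseteq E}(x-1)^{k(A)-k(E)}(y-1)^{k(A)+|A|-|V|}$, and $Z_G(q,v)=\sum_{A\subseteq E}q^{k(A)}v^{|A|}$. For an edge $e$, $G-e$ is the graph obtained by deleting the edge $e$ (keeping all vertices). For an edge $e=(u,v)$, $G\Delta e$ is the simple graph obtained from $G$ by deleting the vertices $u$ and $v$ and adding a new vertex $w$ joined exactly to those vertices of $V(G)\setminus\{u,v\}$ that are adjacent in $G$ to exactly one of $u$ and $v$, i.e. $w$ is joined to the symmetric difference of $N(u)\setminus\{v\}$ and $N(v)\setminus\{u\}$. *)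

(* Defs.v *)
From HB Require Import structures.
From mathcomp Require Import all_boot all_order all_algebra.

Set Implicit Arguments.
Unset Strict Implicit.
Unset Printing Implicit Defensive.

Import GRing.Theory.
Local Open Scope ring_scope.

Record sgraph := SGraph {
  svertex :> finType;
  adj : rel svertex;
  adj_sym : symmetric adj;
  adj_irrefl : irreflexive adj
}.

Definition sgraph_iso (G H : sgraph) : Prop :=
  exists2 f : G -> H, bijective f & {mono f : x y / adj x y}.

Definition edges (G : sgraph) : {set {set G}} :=
  [set [set p.1; p.2] | p in [pred p : G * G | adj p.1 p.2]].

Definition spanning_rel (G : sgraph) (A : {set {set G}}) : rel G :=
  [rel x y | [set x; y] \in A].

Definition ncomp (G : sgraph) (A : {set {set G}}) : nat :=
  n_comp (spanning_rel A) G.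

Definition Zpoly (R : comNzRingType) (G : sgraph) (q v : R) : R :=
  \sum_(A in powerset (edges G)) q ^+ ncomp A * v ^+ #|A|.

(* The natural number subtractions are never truncated: for A a set of edges,
   k(E) <= k(A) and |V| <= k(A) + |A|. *)
Definition Tutte (R : comNzRingType) (G : sgraph) (x y : R) : R :=
  \sum_(A in powerset (edges G))
     (x - 1) ^+ (ncomp A - ncomp (edges G))%N *
     (y - 1) ^+ (ncomp A + #|A| - #|G|)%N.

Definition Ppoly (G : sgraph) : {poly rat} :=
  (2 ^+ #|G|)^-1 *: Zpoly G (2 *: 'X) (- 2).

Section Operations.
Variables (G : sgraph) (u v : G).

Definition del_adj : rel G :=
  [rel x y | adj x y && ([set x; y] != [set u; v])].

Lemma del_adj_sym : symmetric del_adj.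
Proof. by move=> x y; rewrite /del_adj /= adj_sym setUC. Qed.

Lemma del_adj_irrefl : irreflexive del_adj.
Proof. by move=> x; rewrite /del_adj /= adj_irrefl. Qed.

Definition del_edge : sgraph := SGraph del_adj_sym del_adj_irrefl.

(* [None] is the new vertex w. *)
Definition delta_vertex : finType := option {x : G | x \notin [set u; v]}.

Definition delta_adj : rel delta_vertex := fun a b =>
  match a, b with
  | Some x, Some y => adj (val x) (val y)
  | None, Some y => adj u (val y) (+) adj v (val y)
  | Some x, None => adj u (val x) (+) adj v (val x)
  | None, None => false
  end.

Lemma delta_adj_sym : symmetric delta_adj.
Proof. by case=> [x|] [y|] //=; rewrite adj_sym. Qed.

Lemma delta_adj_irrefl : irreflexive delta_adj.
Proof. by case=> [x|] //=; rewrite adj_irrefl. Qed.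

Definition delta_edge : sgraph := SGraph delta_adj_sym delta_adj_irrefl.

End Operations.

Section Edgeless.
Variable n : nat.

Definition no_adj : rel 'I_n := fun _ _ => false.

Lemma no_adj_sym : symmetric no_adj. Proof. by []. Qed.

Lemma no_adj_irrefl : irreflexive no_adj. Proof. by []. Qed.

Definition edgeless : sgraph := SGraph no_adj_sym no_adj_irrefl.

End Edgeless.

Definition graph_polynomial (Q : sgraph -> {poly rat}) : Prop :=
  forall G H : sgraph, sgraph_iso G H -> Q G = Q H.

Definition delta_recursion (Q : sgraph -> {poly rat}) : Prop :=
  forall (G : sgraph) (u v : G), adj u v ->
    Q G = Q (del_edge u v) - Q (delta_edge u v).

Definition edgeless_condition (Q : sgraph -> {poly rat}) : Prop :=
  forall n : nat, (1 <= n)%N -> Q (edgeless n) = 'X^n.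

(* [delta_value G p]: some order of choosing the edges makes the recursion,
   run from G down to edgeless graphs, return the value p. *)
Inductive delta_value : sgraph -> {poly rat} -> Prop :=
| DeltaEdgeless (G : sgraph) (n : nat) :
    (1 <= n)%N -> sgraph_iso G (edgeless n) -> delta_value G 'X^n
| DeltaStep (G : sgraph) (u v : G) (p q : {poly rat}) :
    adj u v -> delta_value (del_edge u v) p ->
    delta_value (delta_edge u v) q -> delta_value G (p - q).

(* Main.v *)
(* Expanding the product over the edges, 2^|V| P(G, m/2) is the sum over all
   m-colourings of V of (-1)^(number of monochromatic edges), since exactly
   m^k(A) colourings are constant on the edges of A.  Only colourings with
   s u = s v see the edge uv, which flips their sign; they are the colourings
   of the contraction, where two parallel edges contribute (-1)^2 = 1 and so can
   be removed, leaving G Delta uv.  The polynomial identities then hold because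
   they hold at the infinitely many points m/2.  Counting colourings with two
   colours also gives k(E) <= k(A) <= |V| <= k(A) + |A|, from which the Tutte
   form follows term by term. *)
Require Import Defs.
From HB Require Import structures.
From mathcomp Require Import all_boot all_order all_algebra.
From mathcomp Require Import ring.

Set Implicit Arguments.
Unset Strict Implicit.
Unset Printing Implicit Defensive.

Import GRing.Theory Num.Theory.
Local Open Scope ring_scope.

(** * Edges as unordered pairs *)

Lemma edgesP (G : sgraph) (e : {set G}) :
  reflect (exists x y, adj x y /\ e = [set x; y]) (e \in edges G).
Proof.
apply: (iffP imsetP) => [[[x y]] /= xy ->|[x [y [xy ->]]]]; first by exists x, y.
by exists (x, y).
Qed.

Lemma eq_set2 (T : finType) (x y a b : T) : [set x; y] = [set a; b] ->
  (x = a /\ y = b) \/ (x = b /\ y = a).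
Proof.
move=> E.
have /set2P xab : x \in [set a; b] by rewrite -E set21.
have /set2P yab : y \in [set a; b] by rewrite -E set22.
have /set2P axy : a \in [set x; y] by rewrite E set21.
have /set2P bxy : b \in [set x; y] by rewrite E set22.
by case: xab yab axy bxy => -> [] -> [] ? [] ?; subst; auto.
Qed.

Lemma mem_edges2 (G : sgraph) (x y : G) : ([set x; y] \in edges G) = adj x y.
Proof.
apply/edgesP/idP => [[a [b [ab /eq_set2[[-> ->]|[-> ->]]]]]|xy] //.
  by rewrite adj_sym.
by exists x, y.
Qed.

(** * Colourings constant on components *)

Section Colourings.
Variables (G : sgraph) (T : finType).
Implicit Types (s : {ffun G -> T}) (A B : {set {set G}}).

(** Comparing all pairs in [e] avoids choosing an order on the two ends of an edge. *)
Definition mono s (e : {set G}) : bool :=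
  [forall x in e, forall y in e, s x == s y].

Lemma mono2 s x y : mono s [set x; y] = (s x == s y).
Proof.
apply/forall_inP/eqP => [M|sxy a aE].
  by have /forall_inP/(_ y (set22 x y))/eqP := M x (set21 x y).
apply/forall_inP => b bE; apply/eqP.
by case/set2P: aE => ->; case/set2P: bE => ->.
Qed.

Definition flat A : {set {ffun G -> T}} :=
  [set s | [forall e in A, mono s e]].

Lemma spanning_rel_sym A : symmetric (spanning_rel A).
Proof. by move=> x y; rewrite /spanning_rel /= setUC. Qed.

Lemma spanning_csym A : connect_sym (spanning_rel A).
Proof. exact: sym_connect_sym (@spanning_rel_sym A). Qed.

Lemma flatP A s : A \subset edges G ->
  reflect (forall x y, connect (spanning_rel A) x y -> s x = s y)
          (s \in flat A).
Proof.
move=> /subsetP AE; rewrite inE.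
apply: (iffP forall_inP) => [M x y|H e eA].
  case/connectP => p; elim: p x => [|z p IH] x /=; first by move=> _ ->.
  case/andP => xz pz /(IH _ pz) <-; apply/eqP.
  by rewrite -mono2; apply: M.
case/edgesP: (AE _ eA) => x [y [_ eE]]; rewrite eE mono2; apply/eqP.
by apply: H; apply: connect1; rewrite /spanning_rel /= -eE.
Qed.

(** A flat colouring is a free choice of one colour per component. Components are represented by
    their roots, and [ext] spreads the colour of a root over its component. *)
Lemma card_flat A : A \subset edges G -> #|flat A| = (#|T| ^ ncomp A)%N.
Proof.
move=> AE; set r := spanning_rel A.
have rootsP x : roots r (fingraph.root r x) by apply/roots_root/spanning_csym.
pose D := {x : G | roots r x}.
pose pr x : D := exist _ (fingraph.root r x) (rootsP x).
pose ext (t : {ffun D -> T}) : {ffun G -> T} := [ffun x => t (pr x)].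
have prK (d : D) : pr (val d) = d.
  by apply: val_inj => /=; apply/eqP; case: d.
have ext_inj : injective ext.
  by move=> t1 t2 /ffunP E; apply/ffunP => d; have := E (val d); rewrite !ffunE prK.
have -> : flat A = ext @: [set: {ffun D -> T}].
  apply/setP => s; apply/(flatP _ AE)/imsetP => [H|[t _ ->] x y xy].
    exists [ffun d => s (val d)]; first by rewrite inE.
    by apply/ffunP => x; rewrite !ffunE /=; apply: H; apply: connect_root.
  rewrite !ffunE; congr (t _); apply: val_inj => /=.
  by apply/eqP; rewrite root_connect //; apply: spanning_csym.
rewrite card_imset // cardsT card_ffun card_sig; congr (_ ^ _)%N.
by apply: eq_card => x; rewrite !inE /= andbT.
Qed.

Lemma flat0 : flat set0 = setT.
Proof. by apply/setP => s; rewrite !inE; apply/forall_inP => e; rewrite inE. Qed.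

Lemma flatS A B : A \subset B -> flat B \subset flat A.
Proof.
move=> /subsetP AB; apply/subsetP => s; rewrite !inE => /forall_inP M.
by apply/forall_inP => e /AB /M.
Qed.

End Colourings.

(** * Inequalities between numbers of components, edges and vertices *)

Lemma ncomp_le (G : sgraph) (A B : {set {set G}}) :
  A \subset B -> B \subset edges G -> (ncomp B <= ncomp A)%N.
Proof.
move=> AB BE; have AE := subset_trans AB BE.
rewrite -(@leq_exp2l 2) //.
by rewrite -card_bool -!card_flat //; apply/subset_leq_card/flatS.
Qed.

Lemma ncomp0 (G : sgraph) : ncomp (set0 : {set {set G}}) = #|G|.
Proof.
apply/eqP; rewrite -(@eqn_exp2l 2) //; apply/eqP.
by rewrite -card_bool -card_flat ?sub0set // flat0 cardsT card_ffun card_bool.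
Qed.

(* Two-colourings that break the same edge differ, modulo 2, by one that
   respects it. *)
Lemma card_flat_setD1 (G : sgraph) (A : {set {set G}}) e :
  A \subset edges G -> e \in A ->
  (#|flat bool (A :\ e)| <= 2 * #|flat bool A|)%N.
Proof.
move=> /subsetP AE eA.
have /edgesP[x [y [_ eE]]] := AE _ eA.
pose S := [set s : {ffun G -> bool} | s x == s y].
have flatE : flat bool A = flat bool (A :\ e) :&: S.
  apply/setP => s; rewrite !inE -mono2 -eE.
  apply/forall_inP/andP => [M|[/forall_inP M Me] f fA].
    split; last exact: M.
    by apply/forall_inP => f /setD1P[_]; apply: M.
  by have [->//|fe] := eqVneq f e; apply: M; rewrite !inE fe.
rewrite -(cardsID S (flat _ (A :\ e))) -flatE mul2n -addnn leq_add2l.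
have [->|[s0 s0D]] := set_0Vmem (flat bool (A :\ e) :\: S); first by rewrite cards0.
pose h (s : {ffun G -> bool}) : {ffun G -> bool} := [ffun z => s z (+) s0 z].
have h_inj : injective h.
  move=> s t /ffunP E; apply/ffunP => z; have := E z; rewrite !ffunE.
  exact: addIb.
rewrite -(card_imset _ h_inj); apply/subset_leq_card/subsetP => _ /imsetP[s sD ->].
have A'E : A :\ e \subset edges G.
  by apply/subsetP => f /setD1P[_ /AE].
move: s0D sD; rewrite flatE !inE => /andP[s0S s0F] /andP[sS sF].
apply/andP; split; last first.
  by rewrite !ffunE; case: (s x) (s y) (s0 x) (s0 y) s0S sS => [] [] [] [].
apply/forall_inP => f fA; have /edgesP[a [b [_ fE]]] := subsetP A'E _ fA.
move/forall_inP/(_ f fA): s0F; move/forall_inP/(_ f fA): sF.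
by rewrite fE !mono2 !ffunE => /eqP-> /eqP->.
Qed.

(** Induction on the number of edges: removing one at most doubles the number of flat
    two-colourings, so it creates at most one new component. *)
Lemma card_le_ncompD (G : sgraph) (A : {set {set G}}) :
  A \subset edges G -> (#|G| <= ncomp A + #|A|)%N.
Proof.
have [n] := ubnP #|A|; elim: n A => // n IH A; rewrite ltnS => An AE.
have [->|[e eA]] := set_0Vmem A; first by rewrite ncomp0 leq_addr.
have A'E : A :\ e \subset edges G by rewrite (subset_trans _ AE) // subD1set.
have /IH/(_ A'E) : (#|A :\ e| < n)%N.
  by rewrite (leq_trans _ An) // [#|A|](cardsD1 e) eA.
move/leq_trans; apply; rewrite [#|A|](cardsD1 e) eA addnA leq_add2r.
have := card_flat_setD1 AE eA.
by rewrite !card_flat // card_bool -expnS leq_exp2l // addn1.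
Qed.

(** * Expansion over edge sets and evaluation at half-integers *)

Lemma prod_1D (R : comNzRingType) (I : finType) (E : {set I}) (c : I -> R) :
  \prod_(i in E) (1 + c i) = \sum_(A in powerset E) \prod_(i in A) c i.
Proof.
(* Factors outside [E] are written 0 + 1, so the product runs over all of [I] and the subsets not
   contained in [E] contribute 0. *)
rewrite big_mkcond (eq_bigr (fun i => (if i \in E then c i else 0) + 1)); last first.
  by move=> i _; case: ifP; rewrite ?add0r // addrC.
rewrite bigA_distr (bigID (mem (powerset E))) /= [X in _ + X]big1 ?addr0.
  apply: eq_big => // A; rewrite powersetE => /subsetP AE.
  rewrite [RHS]big_mkcond; apply: eq_bigr => i _.
  by case: ifP => // /AE ->.
move=> A; rewrite powersetE => /subsetPn[i iA iE].
by rewrite (bigD1 i) //= iA (negbTE iE) mul0r.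
Qed.

(** The Potts partition function with colours [T], at v = -2: a monochromatic edge has weight 1 + v
    = -1. *)
Definition signsum (G : sgraph) (T : finType) : rat :=
  \sum_(s : {ffun G -> T}) \prod_(e in edges G) (-1) ^+ mono s e.

(** The Fortuin-Kasteleyn expansion: each sign is 1 plus either -2 or 0. After exchanging the sums,
    only the colourings flat on [A] survive in the term of [A]. *)
Lemma Zpoly_signsum (G : sgraph) (T : finType) :
  Zpoly G (#|T|%:R : rat) (- 2) = signsum G T.
Proof.
rewrite /signsum (eq_bigr (fun s => \sum_(A in powerset (edges G))
    \prod_(e in A) (if mono s e then - 2 else 0))); last first.
  move=> s _; rewrite -prod_1D; apply: eq_bigr => e _.
  by case: (mono s e); rewrite ?addr0.
rewrite exchange_big; apply: eq_bigr => A; rewrite powersetE => AE /=.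
rewrite -natrX -card_flat // -sum1_card natr_sum mulr_suml [LHS]big_mkcond.
apply: eq_bigr => s _; rewrite inE.
case: ifPn => [/forall_inP M|/forall_inPn[e eA /negbTE Me]].
  by rewrite mul1r (eq_bigr (fun=> - 2)) ?prodr_const // => e /M ->.
by rewrite (bigD1 e) //= Me mul0r.
Qed.

Lemma horner_Ppoly (G : sgraph) (m : nat) :
  (Ppoly G).[m%:R / 2] = (2 ^+ #|G|)^-1 * signsum G 'I_m.
Proof.
rewrite /Ppoly hornerZ -Zpoly_signsum card_ord; congr (_ * _).
rewrite horner_sum; apply: eq_bigr => A _.
rewrite hornerM !horner_exp hornerZ hornerX [2 * _]mulrC divfK //; congr (_ * _ ^+ _).
by rewrite hornerN hornerMn hornerC.
Qed.

Lemma poly_eq_half_nat (p q : {poly rat}) :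
  (forall m : nat, p.[m%:R / 2] = q.[m%:R / 2]) -> p = q.
Proof.
move=> H; apply/eqP; rewrite -subr_eq0; apply/negP => /negP nz.
(* The size exceeds the degree by one, so this is one root too many. *)
pose rs : seq rat := mkseq (fun m => m%:R / 2) (size (p - q)).
have rs_uniq : uniq rs.
  apply: mkseq_uniq => i j /(mulIf _) E; apply/eqP.
  by rewrite -(eqr_nat rat) E.
have: all (root (p - q)) rs.
  by apply/allP => _ /mapP[m _ ->]; apply/rootP; rewrite hornerD hornerN H subrr.
by move/(max_poly_roots nz)/(_ rs_uniq); rewrite size_mkseq ltnn.
Qed.

(** * The Tutte polynomial form *)

Lemma Ppoly_Tutte (G : sgraph) :
  Ppoly G = (-1) ^+ (#|G| - ncomp (edges G))%N * 'X^(ncomp (edges G)) *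
            Tutte G (1 - 'X) (-1).
Proof.
rewrite /Ppoly /Zpoly /Tutte scaler_sumr mulr_sumr; apply: eq_bigr => A.
rewrite powersetE => AE.
have kEA := ncomp_le AE (subxx _).
have kAV : (ncomp A <= #|G|)%N by rewrite -ncomp0; apply: ncomp_le; rewrite ?sub0set.
have VkA := card_le_ncompD AE.
(* The three inequalities give k(A) = k0 + c, |V| = k0 + c + d and |A| = d + b, which removes every
   truncated subtraction. *)
move: (ncomp A) (ncomp (edges G)) #|A| #|G| kEA kAV VkA => k k0 a n.
move=> /subnKC <-; move: (k - k0)%N => c {k} /subnKC <-.
rewrite leq_add2l; move: (n - _)%N => d {n} /subnKC <-; move: (a - d)%N => b {a}.
have -> : (k0 + c + d - k0 = c + d)%N by rewrite -addnA addKn.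
have -> : (k0 + c + (d + b) - (k0 + c + d) = b)%N by rewrite addnA addKn.
have -> : (k0 + c - k0 = c)%N by rewrite addKn.
have -> : 1 - 'X - 1 = - 'X :> {poly rat} by rewrite addrAC subrr add0r.
have -> : -1 - 1 = - 2 :> {poly rat} by rewrite -opprD.
have -> : (2 *: 'X : {poly rat}) ^+ (k0 + c) = 2 ^+ (k0 + c) *: 'X^(k0 + c).
  by rewrite exprZn.
(* Only d factors 2 are extracted: with the k0 + c others they cancel the denominator 2^|V|. *)
have -> : (- 2 : {poly rat}) ^+ (d + b) = 2 ^+ d *: ((-1) ^+ d * (- 2) ^+ b).
  by rewrite -mul_polyC rmorphXn /= polyC_natr exprD (exprNn 2 d); ring.
rewrite -scalerAl -scalerAr !scalerA -mulrA -exprD mulVf ?expf_neq0 // scale1r.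
rewrite (exprNn 'X c) !exprD.
(* One sign comes from the prefactor, the other from the power of [- 'X]. *)
suff sq : (-1) ^+ c * (-1) ^+ c = 1 :> {poly rat}.
  transitivity (((-1) ^+ c * (-1) ^+ c) *
    ('X^k0 * 'X^c * ((-1) ^+ d * (-2) ^+ b)) : {poly rat}).
    by rewrite sq mul1r.
  by ring.
by rewrite -exprMn mulrNN mulr1 expr1n.
Qed.

(** * Edge products along embeddings and around a vertex *)

Lemma mono_imset (G H : sgraph) (T : finType) (f : G -> H)
    (s : {ffun H -> T}) (e : {set G}) :
  mono s (f @: e) = mono [ffun x => s (f x)] e.
Proof.
apply/forall_inP/forall_inP => [M x xe|M _ /imsetP[x xe ->]].
  apply/forall_inP => y ye; rewrite !ffunE.
  exact: (forall_inP (M _ (imset_f f xe)) _ (imset_f f ye)).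
apply/forall_inP => _ /imsetP[y ye ->].
by have := forall_inP (M _ xe) _ ye; rewrite !ffunE.
Qed.

Lemma edges_embed (S H : sgraph) (f : S -> H) :
  injective f -> {mono f : x y / adj x y} ->
  [set e in edges H | e \subset codom f] = [set f @: (e : {set S}) | e in edges S].
Proof.
move=> f_inj f_mono; apply/setP => e; rewrite inE.
apply/andP/imsetP => [[/edgesP[a [b [ab ->]]] /subsetP sub]|[e' eE ->]].
  have /codomP[x xE] := sub a (set21 a b); have /codomP[y yE] := sub b (set22 a b).
  exists [set x; y]; first by rewrite mem_edges2 -f_mono -xE -yE.
  by rewrite imsetU1 imset_set1 -xE -yE.
case/edgesP: eE => x [y [xy ->]]; rewrite imsetU1 imset_set1 mem_edges2 f_mono.
by split=> //; apply/subsetP => z /set2P[] ->; apply: codom_f.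
Qed.

(** [f] makes [S] an induced subgraph of [H]. This serves both for isomorphisms and for the part of
    the graph away from a contracted edge. *)
Lemma prod_edges_embed (R : comNzRingType) (S H : sgraph) (f : S -> H)
    (F : {set H} -> R) :
  injective f -> {mono f : x y / adj x y} ->
  \prod_(e in edges H | e \subset codom f) F e =
  \prod_(e in edges S) F (f @: e).
Proof.
move=> f_inj f_mono; rewrite -[RHS](big_imset F); last first.
  by move=> e1 e2 _ _; apply: imset_inj.
by rewrite -edges_embed //; apply: eq_bigl => e; rewrite inE.
Qed.

Lemma signsum_iso (G H : sgraph) (T : finType) :
  sgraph_iso G H -> signsum G T = signsum H T.
Proof.
case=> f [g fK gK] f_mono; rewrite /signsum.
rewrite (reindex (fun s : {ffun H -> T} => [ffun x => s (f x)])) /=; last first.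
  exists (fun s : {ffun G -> T} => [ffun x => s (g x)]) => s _;
    by apply/ffunP => x; rewrite !ffunE ?fK ?gK.
apply: eq_bigr => s _.
transitivity (\prod_(e in edges G) (-1) ^+ mono s (f @: e) : rat).
  by apply: eq_bigr => e _; rewrite mono_imset.
rewrite -(prod_edges_embed (fun e => (-1) ^+ mono s e)) //; last exact: can_inj fK.
apply: eq_bigl => e; rewrite andb_idr // => _.
by apply/subsetP => x _; rewrite -[x]gK; apply: codom_f.
Qed.

(** The edges at [w] correspond to its neighbours. The predicate [P] lets the splitting be repeated
    at a second vertex. *)
Lemma prod_star (R : comNzRingType) (G : sgraph) (w : G) (P : pred {set G})
    (F : {set G} -> R) :
  \prod_(e in edges G | P e) F e =
  (\prod_(y | adj w y && P [set w; y]) F [set w; y]) *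
  \prod_(e in edges G | P e && (w \notin e)) F e.
Proof.
rewrite (bigID (fun e : {set G} => w \in e)) /=; congr (_ * _); last first.
  by apply: eq_bigl => e; rewrite andbA.
pose nbrs := [set y | adj w y && P [set w; y]].
transitivity (\prod_(e in [set [set w; y] | y in nbrs]) F e); last first.
  rewrite big_imset => [|y z _ _ /eq_set2[[]|[-> ->]]] //.
  by apply: eq_bigl => y; rewrite inE.
apply: eq_bigl => e.
apply/andP/imsetP => [[/andP[/edgesP[x [y [xy ->]]] Pe] /set2P wE]|[y]].
  case: wE => wE; [exists y | exists x]; rewrite ?inE wE //.
    by rewrite xy.
  - by rewrite adj_sym xy setUC.
  exact: setUC.
by rewrite inE => /andP[wy Py] ->; rewrite mem_edges2 wy Py set21.
Qed.

Lemma prod_star_all (R : comNzRingType) (G : sgraph) (w : G)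
    (F : {set G} -> R) :
  \prod_(e in edges G) F e =
  (\prod_(y | adj w y) F [set w; y]) * \prod_(e in edges G | w \notin e) F e.
Proof.
rewrite (eq_bigl (fun e => (e \in edges G) && xpredT e)) => [|e]; last first.
  by rewrite andbT.
by rewrite (prod_star w); congr (_ * _); apply: eq_bigl => e; rewrite ?andbT.
Qed.

(** * Deletion and contraction of an edge *)

Lemma edges_del (G : sgraph) (u v : G) :
  edges (del_edge u v) = edges G :\ [set u; v].
Proof.
apply/setP => e; rewrite !inE.
apply/edgesP/andP => [[x [y [/andP[xy ne] ->]]]|[ne /edgesP[x [y [xy eE]]]]].
  by rewrite ne mem_edges2.
by exists x, y; split=> //; rewrite /= /del_adj /= xy -eE.
Qed.

Section Contract.
Variables (G : sgraph) (u v : G) (T : finType).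
Hypothesis uv : adj u v.

Let S : finType := {x : G | x \notin [set u; v]}.

Lemma outer_sym : symmetric (fun x y : S => adj (val x) (val y)).
Proof. by move=> x y; rewrite adj_sym. Qed.

Lemma outer_irrefl : irreflexive (fun x y : S => adj (val x) (val y)).
Proof. by move=> x; rewrite adj_irrefl. Qed.

(** The graph G - u - v, an induced subgraph of both [del_edge u v] and [delta_edge u v]. *)
Definition outer : sgraph := SGraph outer_sym outer_irrefl.

(** [insub] sends both [u] and [v] to [None], so it is the contraction map on vertices. *)
Definition pullback (t : {ffun delta_edge u v -> T}) : {ffun G -> T} :=
  [ffun x => t (insub x)].

Lemma pullback_u t : pullback t u = t None.
Proof. by rewrite ffunE insubN // negbK set21. Qed.

Lemma pullback_v t : pullback t v = t None.
Proof. by rewrite ffunE insubN // negbK set22. Qed.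

Lemma pullback_val t (y : S) : pullback t (val y) = t (Some y).
Proof. by rewrite ffunE valK. Qed.

Lemma prod_outer_val (F : {set G} -> rat) :
  \prod_(e in edges (del_edge u v) | (u \notin e) && (v \notin e)) F e =
  \prod_(e in edges outer) F (val @: e).
Proof.
rewrite -(prod_edges_embed (S := outer) (H := del_edge u v) (f := val)) //.
- apply: eq_bigl => e; congr (_ && _); apply/andP/subsetP => [[ue ve] x xe|sub].
    have xS : x \notin [set u; v].
      by apply/negP => /set2P[] xE; rewrite -xE xe in ue ve.
    by rewrite -[x]/(val (Sub x xS : S)); apply: (codom_f (val : outer -> G)).
  by split; apply/negP => /sub /codomP[[x /= xS] xE]; rewrite -xE !inE eqxx ?orbT in xS.
- exact: val_inj.
- move=> x y; rewrite /= /del_adj /= andb_idr // => _.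
  by apply: contraNneq (valP x) => /setP/(_ (val x)); rewrite set21 => <-.
Qed.

Lemma prod_outer_Some (F : {set delta_edge u v} -> rat) :
  \prod_(e in edges (delta_edge u v) | None \notin e) F e =
  \prod_(e in edges outer) F ((Some : outer -> delta_edge u v) @: e).
Proof.
rewrite -(prod_edges_embed (S := outer) (H := delta_edge u v) (f := Some)) //.
  apply: eq_bigl => e; congr (_ && _); apply/idP/subsetP => [ne [x xe|]|sub].
  - exact: (codom_f (Some : outer -> delta_edge u v)).
  - by move=> ne'; rewrite ne' in ne.
  by apply/negP => /sub /codomP[].
by move=> x y [].
Qed.

(** Without loops, an edge at [w] that stays inside the pair can only be the deleted one. *)
Lemma del_adj_out (w y : G) : w \in [set u; v] ->
  del_adj u v w y = adj w y && (y \notin [set u; v]).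
Proof.
move=> wE; rewrite /del_adj /=; apply: andb_id2l => wy; congr (~~ _).
apply/eqP/idP => [<-|yE]; first exact: set22.
case/set2P: wE yE wy => -> /set2P[] ->; rewrite ?adj_irrefl // => _.
exact: setUC.
Qed.

Lemma prod_out (w : G) (F : G -> rat) : w \in [set u; v] ->
  \prod_(y | del_adj u v w y) F y = \prod_(y : S | adj w (val y)) F (val y).
Proof.
move=> wE; rewrite (reindex_omap (val : S -> G) insub) => [|y]; last first.
  by rewrite del_adj_out // => /andP[_ yS]; rewrite insubT.
by apply: eq_bigl => y; rewrite del_adj_out // valK eqxx (valP y) !andbT.
Qed.

(* Edges from [u] and [v] to a common neighbour receive the same sign, so they
   cancel; the remaining ones are the edges at the new vertex. *)
Lemma prod_pullback (t : {ffun delta_edge u v -> T}) :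
  \prod_(e in edges (del_edge u v)) (-1) ^+ mono (pullback t) e =
  \prod_(e in edges (delta_edge u v)) (-1) ^+ mono t e :> rat.
Proof.
set F := fun e : {set G} => (-1) ^+ mono (pullback t) e : rat.
set F' := fun e => (-1) ^+ mono t e : rat.
rewrite [LHS](@prod_star_all _ (del_edge u v) u F).
rewrite [X in _ * X](@prod_star _ (del_edge u v) v).
rewrite [RHS](@prod_star_all _ (delta_edge u v) None F') prod_outer_val mulrA.
rewrite prod_outer_Some; congr (_ * _); last first.
  apply: eq_bigr => e _; rewrite /F /F'; congr (_ ^+ nat_of_bool _).
  rewrite (@mono_imset outer G) (@mono_imset outer (delta_edge u v)).
  congr mono; apply/ffunP => y; by rewrite !ffunE valK.
(* Having split off the star of [u] first, the star of [v] must avoid [u]; this is automatic once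
   [uv] is deleted. *)
rewrite [X in _ * X](eq_bigl (del_adj u v v)) => [|y]; last first.
  rewrite andb_idr //= del_adj_out ?set22 // => /andP[_]; apply: contra.
  case/set2P => [uE|<-]; last exact: set21.
  by move: uv; rewrite uE adj_irrefl.
rewrite !prod_out ?set21 ?set22 //.
rewrite [RHS](reindex_omap (Some : S -> delta_edge u v) id) => [|[]] //.
rewrite [RHS](eq_bigl (fun y : S => adj u (val y) (+) adj v (val y))); last first.
  by move=> y; rewrite /= eqxx andbT.
rewrite [X in X * _]big_mkcond [X in _ * X]big_mkcond -big_split.
rewrite [RHS]big_mkcond /=; apply: eq_bigr => y _.
rewrite /F /F' !mono2 pullback_u pullback_v pullback_val.
by case: (adj u _); case: (adj v _); rewrite ?mulr1 ?mul1r //= -expr2 sqrr_sign.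
Qed.

Lemma signsum_contract :
  \sum_(s : {ffun G -> T} | s u == s v)
     \prod_(e in edges (del_edge u v)) (-1) ^+ mono s e =
  signsum (delta_edge u v) T.
Proof.
(* The new vertex takes the colour of [u]; this inverts [pullback] on the colourings with
   [s u = s v]. *)
pose push (s : {ffun G -> T}) : {ffun delta_edge u v -> T} :=
  [ffun o : delta_edge u v => if o is Some y then s (val y) else s u].
rewrite (reindex_onto pullback push); last first.
  move=> s /eqP suv; apply/ffunP => x; rewrite ffunE.
  case: insubP => [y _ <-|]; rewrite ?ffunE // negbK.
  by case/set2P => ->.
apply: eq_big => [t|t _]; last exact: prod_pullback.
rewrite pullback_u pullback_v eqxx /=; apply/eqP/ffunP => -[y|].
  by rewrite ffunE pullback_val.
by rewrite ffunE pullback_u.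
Qed.

(** If [p] is the product over the other edges, a colouring with [s u = s v] contributes -p = p -
    2p, and any other contributes p. *)
Lemma signsum_recursion :
  signsum G T = signsum (del_edge u v) T - 2 * signsum (delta_edge u v) T.
Proof.
rewrite -signsum_contract /signsum [in X in 2 * X]big_mkcond mulr_sumr -sumrB.
apply: eq_bigr => s _.
rewrite (big_setD1 [set u; v]) ?mem_edges2 //= edges_del mono2.
set p := \prod_(_ in _) _.
by case: eqP => _; rewrite ?mul1r ?mulr0 ?subr0 // expr1; ring.
Qed.

Lemma card_delta : #|G| = #|delta_edge u v|.+1.
Proof.
rewrite /= card_option card_sig -(cardsC [set u; v]) cards2.
have -> : u != v by apply: contraTneq uv => ->; rewrite adj_irrefl.
by congr (_.+2); apply: eq_card => x; rewrite !inE.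
Qed.

End Contract.

(** * The recursion for [Ppoly] and independence of the order of edges *)

Lemma Ppoly_recursion : delta_recursion Ppoly.
Proof.
move=> G u v uv; apply: poly_eq_half_nat => m.
rewrite hornerD hornerN !horner_Ppoly (signsum_recursion _ uv).
(* Contraction loses one vertex, so the normalisation by 2^|V| absorbs the factor 2. *)
rewrite mulrBr; congr (_ - _); rewrite (card_delta uv) exprS invfM.
by rewrite mulrACA mulVf // mul1r.
Qed.

Lemma Ppoly_edgeless : edgeless_condition Ppoly.
Proof.
move=> n _; apply: poly_eq_half_nat => m.
rewrite horner_Ppoly hornerXn /signsum.
have -> : edges (edgeless n) = set0.
  by apply/setP => e; rewrite inE; apply/edgesP => -[x [y []]].
rewrite (eq_bigr (fun=> 1)) => [|s _]; last by rewrite big_set0.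
by rewrite sumr_const card_ffun !card_ord natrX expr_div_n mulrC.
Qed.

Lemma Ppoly_iso : graph_polynomial Ppoly.
Proof.
move=> G H GH; apply: poly_eq_half_nat => m.
rewrite !horner_Ppoly (signsum_iso _ GH).
by case: GH => f /bij_eq_card ->.
Qed.

(** Induction on the run of the recursion: [Ppoly] obeys the same rules, so the choice of edges
    cannot matter. *)
Lemma delta_value_Ppoly (G : sgraph) (p : {poly rat}) :
  delta_value G p -> p = Ppoly G.
Proof.
elim=> {G p} [G n n0 /Ppoly_iso ->|G u v p q uv _ -> _ ->].
  by rewrite Ppoly_edgeless.
by rewrite (Ppoly_recursion uv).
Qed.

(** Lexicographic induction: deletion keeps the vertices and loses an edge, contraction loses a
    vertex but never the last one, since the new vertex remains. *)
Lemma delta_value_exists (G : sgraph) :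
  (0 < #|G|)%N -> exists p, delta_value G p.
Proof.
have [n] := ubnP #|G|; elim: n G => // n IHn G; rewrite ltnS.
have [m] := ubnP #|edges G|; elim: m G => // m IHm G; rewrite ltnS => Gm Gn G0.
case: (pickP (fun p : G * G => adj p.1 p.2)) => [[u v] /= uv|noadj].
  have [] // := IHm (del_edge u v).
    rewrite (leq_trans _ Gm) // edges_del.
    by rewrite [#|edges G|](cardsD1 [set u; v]) mem_edges2 uv.
  move=> p Hp; have [] := IHn (delta_edge u v).
  - by rewrite -(card_delta uv).
  - by apply/card_gt0P; exists None.
  by move=> q Hq; exists (p - q); apply: DeltaStep Hp Hq.
exists 'X^#|G|; apply: DeltaEdgeless => //.
exists (fun x => enum_rank x : edgeless #|G|); first exact: enum_rank_bij.
by move=> x y /=; rewrite [RHS](noadj (x, y)).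
Qed.

Theorem theorem2p1 :
  (forall G : sgraph,
     Ppoly G = (-1) ^+ (#|G| - ncomp (edges G))%N * 'X^(ncomp (edges G)) *
               Tutte G (1 - 'X) (-1)) /\
  delta_recursion Ppoly /\
  edgeless_condition Ppoly /\
  (exists Q : sgraph -> {poly rat},
     [/\ graph_polynomial Q, delta_recursion Q & edgeless_condition Q]) /\
  (forall G : sgraph, (0 < #|G|)%N -> exists! p : {poly rat}, delta_value G p).
Proof.
split; first exact: Ppoly_Tutte.
split; first exact: Ppoly_recursion.
split; first exact: Ppoly_edgeless.
split.
  exists Ppoly; split;
    [exact: Ppoly_iso | exact: Ppoly_recursion | exact: Ppoly_edgeless].
move=> G /delta_value_exists[p Gp]; exists p; split=> // q /delta_value_Ppoly ->.
exact: delta_value_Ppoly.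
Qed.
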